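(* Let $(X,T)$ be a compact Hausdorff flow. Then $(X,T)$ satisfies the Furstenberg condition if and only if $(X,T)$ is equicontinuous. Moreover, if these equivalent conditions hold, then every point of $X$ is almost automorphic.
   Context: $X$ is a compact Hausdorff space and $T$ a topological group acting continuously on the left of $X$ (a compact Hausdorff flow). $\mathcal U$ denotes the unique uniform structure of $X$, i.e. the set of neighborhoods of the diagonal in $X\times X$ (entourages). The flow is equicontinuous if for every $\alpha\in\mathcal U$ there is $\beta\in\mathcal U$ such that $(x,y)\in\beta$ implies $(tx,ty)\in\alpha$ for all $t\in T$. The flow satisfies the Furstenberg condition if for every $\alpha\in\mathcal U$ there exists $\beta\in\mathcal U$ such that whenever $(tx,x)\in\beta$ and $(y,x)\in\beta$ for some $x,y\in X$, $t\in T$, we have $(ty,x)\in\alpha$. A point $x\in X$ is almost automorphic if for every net $\{t_i\}\subset T$ with $t_ix\to y$ for some $y\in X$ it holds that $t_i^{-1}y\to x$. *)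

(* Defs.v *)
From Stdlib Require Import List.
Set Implicit Arguments.

Record topology (X : Type) := Topology {
  open : (X -> Prop) -> Prop;
  open_full : open (fun _ => True);
  open_inter : forall U V, open U -> open V -> open (fun x => U x /\ V x);
  open_union : forall F : (X -> Prop) -> Prop,
      (forall U, F U -> open U) -> open (fun x => exists U, F U /\ U x)
}.
Arguments open {X} t U.

Definition prod_open {X Y : Type} (tX : topology X) (tY : topology Y)
  (W : X * Y -> Prop) : Prop :=
  forall p, W p -> exists A B, open tX A /\ open tY B /\ A (fst p) /\ B (snd p) /\
    forall a b, A a -> B b -> W (a, b).

Definition continuous {A B : Type} (openA : (A -> Prop) -> Prop)
  (openB : (B -> Prop) -> Prop) (f : A -> B) : Prop :=
  forall V, openB V -> openA (fun a => V (f a)).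

Definition compact {X : Type} (t : topology X) : Prop :=
  forall F : (X -> Prop) -> Prop,
    (forall U, F U -> open t U) ->
    (forall x, exists U, F U /\ U x) ->
    exists l : list (X -> Prop), (forall U, In U l -> F U) /\
      (forall x, exists U, In U l /\ U x).

Definition hausdorff {X : Type} (t : topology X) : Prop :=
  forall x y, x <> y -> exists U V, open t U /\ open t V /\ U x /\ V y /\
    forall z, ~ (U z /\ V z).

Definition topological_group {T : Type} (tT : topology T)
  (mul : T -> T -> T) (inv : T -> T) (e : T) : Prop :=
  (forall a b c, mul a (mul b c) = mul (mul a b) c) /\
  (forall a, mul e a = a) /\ (forall a, mul a e = a) /\
  (forall a, mul (inv a) a = e) /\ (forall a, mul a (inv a) = e) /\
  continuous (prod_open tT tT) (open tT) (fun p => mul (fst p) (snd p)) /\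
  continuous (open tT) (open tT) inv.

Definition continuous_action {T X : Type} (tT : topology T) (tX : topology X)
  (mul : T -> T -> T) (e : T) (act : T -> X -> X) : Prop :=
  (forall x, act e x = x) /\
  (forall s t x, act (mul s t) x = act s (act t x)) /\
  continuous (prod_open tT tX) (open tX) (fun p => act (fst p) (snd p)).

(** Entourages of the (unique) uniformity of a compact Hausdorff space:
    neighborhoods of the diagonal in X * X. *)
Definition entourage {X : Type} (tX : topology X) (U : X * X -> Prop) : Prop :=
  exists W, prod_open tX tX W /\ (forall x, W (x, x)) /\ (forall p, W p -> U p).

Definition equicontinuous {T X : Type} (tX : topology X) (act : T -> X -> X) : Prop :=
  forall alpha, entourage tX alpha ->
    exists beta, entourage tX beta /\
      forall x y, beta (x, y) -> forall t, alpha (act t x, act t y).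

Definition furstenberg {T X : Type} (tX : topology X) (act : T -> X -> X) : Prop :=
  forall alpha, entourage tX alpha ->
    exists beta, entourage tX beta /\
      forall x y t, beta (act t x, x) -> beta (y, x) -> alpha (act t y, x).

Definition directed {I : Type} (le : I -> I -> Prop) : Prop :=
  (exists i : I, True) /\ (forall i, le i i) /\
  (forall i j k, le i j -> le j k -> le i k) /\
  (forall i j, exists k, le i k /\ le j k).

Definition net_converges {I X : Type} (tX : topology X) (le : I -> I -> Prop)
  (f : I -> X) (y : X) : Prop :=
  forall U, open tX U -> U y -> exists i0, forall i, le i0 i -> U (f i).

Definition almost_automorphic {T X : Type} (tX : topology X) (inv : T -> T)
  (act : T -> X -> X) (x : X) : Prop :=
  forall (I : Type) (le : I -> I -> Prop) (t : I -> T) (y : X),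
    directed le ->
    net_converges tX le (fun i => act (t i) x) y ->
    net_converges tX le (fun i => act (inv (t i)) y) x.

(* Main.v *)
(** From Furstenberg to equicontinuity at a point [x]: cover [X] by finitely
    many [beta]-small open sets and, for each one met by the orbit of [x], fix
    some [s] moving [x] into it.  If [t x] lies in the same set as [s x], then
    [t s^-1] almost fixes [p = s x], so the Furstenberg condition applied at
    [p] sends [s y], which is near [p] for [y] near [x], to a point [t y] near
    [p].  Conversely an equicontinuous flow keeps [t y] near [t x], which is
    near [x].  Almost automorphy follows by applying equicontinuity to
    [t_i^-1], since [t_i^-1 (t_i x) = x]. *)
From Stdlib Require Import List Classical.
Require Import Defs.
Set Implicit Arguments.
Unset Strict Implicit.

(** * Uniformity of a compact Hausdorff space *)

Section Topology.

Variables (X : Type) (tX : topology X).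

Lemma open_empty : open tX (fun x => exists U, False /\ U x).
Proof. apply open_union. tauto. Qed.

Lemma open_union2 (U V : X -> Prop) :
  open tX U -> open tX V ->
  exists W, open tX W /\ forall x, W x <-> U x \/ V x.
Proof.
  intros HU HV.
  exists (fun x => exists A, (A = U \/ A = V) /\ A x). split.
  - apply open_union. intros A [-> | ->]; assumption.
  - intros x. split.
    + intros (A & [-> | ->] & HA); auto.
    + intros [H | H]; eauto.
Qed.

Lemma prod_open_inter (W1 W2 : X * X -> Prop) :
  prod_open tX tX W1 -> prod_open tX tX W2 ->
  prod_open tX tX (fun p => W1 p /\ W2 p).
Proof.
  intros H1 H2 p [h1 h2].
  destruct (H1 p h1) as (A1 & B1 & oA1 & oB1 & a1 & b1 & K1).
  destruct (H2 p h2) as (A2 & B2 & oA2 & oB2 & a2 & b2 & K2).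
  exists (fun x => A1 x /\ A2 x), (fun x => B1 x /\ B2 x).
  repeat split; auto using open_inter; firstorder.
Qed.

Lemma prod_open_squares (F : (X -> Prop) -> Prop) :
  (forall U, F U -> open tX U) ->
  prod_open tX tX (fun p => exists U, F U /\ U (fst p) /\ U (snd p)).
Proof.
  intros HF p (U & FU & h1 & h2).
  exists U, U. repeat split; auto. intros a b ha hb. exists U. auto.
Qed.

Lemma prod_open_diag_square (W : X * X -> Prop) (x : X) :
  prod_open tX tX W -> W (x, x) ->
  exists U, open tX U /\ U x /\ forall a b, U a -> U b -> W (a, b).
Proof.
  intros HW hx. destruct (HW _ hx) as (A & B & oA & oB & ha & hb & K).
  exists (fun z => A z /\ B z). repeat split; auto using open_inter.
  intros a b [? _] [_ ?]; auto.
Qed.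

Lemma entourage_squares (F : (X -> Prop) -> Prop) :
  (forall U, F U -> open tX U) -> (forall x, exists U, F U /\ U x) ->
  entourage tX (fun p => exists U, F U /\ U (fst p) /\ U (snd p)).
Proof.
  intros HF Hcov. eexists. split; [exact (prod_open_squares HF) |].
  split; [| auto].
  intros x. destruct (Hcov x) as (U & FU & h). exists U. auto.
Qed.

Hypotheses (HXc : compact tX) (HXh : hausdorff tX).

(** Cover [X] by [N] together with the open sets [V] that miss some open [U] around [x], and take a
    finite subcover: [M] is the intersection of the chosen [U]s, [C] the union of the corresponding
    [V]s. *)
Lemma compact_hausdorff_regular (N : X -> Prop) (x : X) :
  open tX N -> N x ->
  exists M C, open tX M /\ open tX C /\ M x /\
    (forall z, ~ (M z /\ C z)) /\ forall z, N z \/ C z.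
Proof.
  intros oN hx.
  pose (F := fun V => open tX V /\ (V = N \/
    exists U, open tX U /\ U x /\ forall z, ~ (U z /\ V z))).
  destruct (@HXc F) as (l & lF & lcov).
  - intros U [H _]; exact H.
  - intros z. destruct (classic (x = z)) as [<- | ne].
    + exists N. unfold F. auto.
    + destruct (HXh ne) as (U & V & oU & oV & hU & hV & d).
      exists V. unfold F. eauto 10.
  (* A sublist need not cover [X], so the induction claims the alternative only on the union of the
     list; [lcov] removes this restriction at the end. *)
  - assert (K : exists M C, open tX M /\ open tX C /\ M x /\
      (forall z, ~ (M z /\ C z)) /\
      forall z, (exists U, In U l /\ U z) -> N z \/ C z).
    { clear lcov. induction l as [| V l IH].
      - exists (fun _ => True), (fun z => exists U, False /\ U z).
        repeat split; auto using open_full, open_empty; firstorder.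
      - destruct IH as (M & C & oM & oC & hM & d & c).
        { intros U HU. apply lF. right; exact HU. }
        destruct (lF V (or_introl eq_refl))
          as (oV & [-> | (U & oU & hU & dU)]).
        + exists M, C. repeat split; auto.
          intros z (A & [<- | HA] & hA); [auto | apply c; eauto].
        + destruct (open_union2 oV oC) as (C' & oC' & hC').
          exists (fun z => U z /\ M z), C'.
          repeat split; auto using open_inter.
          * intros z [[h1 h2] h3]. apply hC' in h3.
            destruct h3; [apply (dU z) | apply (d z)]; auto.
          * intros z (A & [<- | HA] & hA); rewrite hC'; [auto |].
            destruct (c z); eauto. }
    destruct K as (M & C & oM & oC & hM & d & c).
    exists M, C. repeat split; auto.
Qed.

(* The halving [V] is the finite intersection of the sets
   [N x N \/ C x C], where [C \/ N = X] and the open sets [M] disjoint from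
   [C] cover [X]: a middle point in [M] forces its [V]-neighbours into [N]. *)
Lemma entourage_halving (alpha : X * X -> Prop) :
  entourage tX alpha ->
  exists V, entourage tX V /\ (forall a b, V (a, b) -> V (b, a)) /\
    forall a b c, V (a, b) -> V (b, c) -> alpha (a, c).
Proof.
  intros (W & oW & rW & sub).
  pose (F := fun M => open tX M /\ exists N C, open tX N /\ open tX C /\
    (forall a b, N a -> N b -> W (a, b)) /\
    (forall z, ~ (M z /\ C z)) /\ forall z, N z \/ C z).
  destruct (@HXc F) as (l & lF & lcov).
  - intros U [H _]; exact H.
  - intros x.
    destruct (prod_open_diag_square oW (rW x)) as (N & oN & hN & K).
    destruct (compact_hausdorff_regular oN hN)
      as (M & C & oM & oC & hM & d & c).
    exists M. unfold F. eauto 12.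
  - assert (K : exists V, prod_open tX tX V /\ (forall x, V (x, x)) /\
      (forall a b, V (a, b) -> V (b, a)) /\
      forall M, In M l -> forall a b c,
        M b -> V (a, b) -> V (b, c) -> W (a, c)).
    { clear lcov. induction l as [| M l IH].
      - exists (fun _ => True). repeat split; auto.
        + intros p _. exists (fun _ => True), (fun _ => True).
          repeat split; auto using open_full.
        + intros M [].
      - destruct IH as (V & oV & rV & sV & tV).
        { intros U HU. apply lF. right; exact HU. }
        destruct (lF M (or_introl eq_refl))
          as (oM & N & C & oN & oC & sq & d & c).
        pose (Q := fun p : X * X =>
          exists U, (U = N \/ U = C) /\ U (fst p) /\ U (snd p)).
        exists (fun p => V p /\ Q p). repeat split; auto.
        + apply prod_open_inter; auto. apply prod_open_squares.
          intros U [-> | ->]; auto.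
        + unfold Q; destruct (c x); eauto.
        + apply sV, H.
        + destruct H as [_ (U & HU & h1 & h2)]. exists U; auto.
        + intros M' [<- | HM'] a b c' hb [h1 q1] [h2 q2]; [| eauto].
          destruct q1 as (U1 & [-> | ->] & k1 & k1'); simpl in *;
            [| destruct (d b); auto].
          destruct q2 as (U2 & [-> | ->] & k2 & k2'); simpl in *;
            [| destruct (d b); auto].
          auto. }
    destruct K as (V & oV & rV & sV & tV).
    exists V. split; [exists V; auto |]. split; [exact sV |].
    intros a b c h1 h2. destruct (lcov b) as (M & HM & hb). eauto.
Qed.

Lemma entourage_inter (U V : X * X -> Prop) :
  entourage tX U -> entourage tX V -> entourage tX (fun p => U p /\ V p).
Proof.
  intros (U' & oU & rU & sU) (V' & oV & rV & sV).
  exists (fun p => U' p /\ V' p). split; [apply prod_open_inter; auto |].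
  firstorder.
Qed.

(** Regularity gives an open [C] that misses [x] and covers [X] together with [U]; the slice at [x]
    of [U x U \/ C x C] is then inside [U]. *)
Lemma entourage_ball_in_open (U : X -> Prop) (x : X) :
  open tX U -> U x ->
  exists alpha, entourage tX alpha /\ forall y, alpha (x, y) -> U y.
Proof.
  intros oU hx.
  destruct (compact_hausdorff_regular oU hx)
    as (M & C & oM & oC & hM & d & c).
  exists (fun p => exists A, (A = U \/ A = C) /\ A (fst p) /\ A (snd p)).
  split.
  - apply entourage_squares; [intros A [-> | ->]; auto |].
    intros z. destruct (c z); eauto.
  - intros y (A & [-> | ->] & h1 & h2); auto. destruct (d x); auto.
Qed.

End Topology.

(** * Flows on a compact Hausdorff space *)

Section Flow.

Variables (X T : Type) (tX : topology X) (tT : topology T).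
Variables (mul : T -> T -> T) (inv : T -> T) (e : T) (act : T -> X -> X).
Hypotheses (HXc : compact tX) (HXh : hausdorff tX).
Hypotheses (HT : topological_group tT mul inv e)
  (Hact : continuous_action tT tX mul e act).

Lemma act_inv_act (s : T) (x : X) : act (inv s) (act s x) = x.
Proof.
  destruct HT as (_ & _ & _ & il & _), Hact as (a1 & am & _).
  rewrite <- am, il. apply a1.
Qed.

Lemma translation_continuous_at (s : T) (x : X) (V : X -> Prop) :
  open tX V -> V (act s x) ->
  exists N, open tX N /\ N x /\ forall y, N y -> V (act s y).
Proof.
  destruct Hact as (_ & _ & ca). intros oV h.
  destruct (ca V oV (s, x) h) as (A & B & _ & oB & hA & hB & K).
  exists B. repeat split; auto. intros y hy. exact (K s y hA hy).
Qed.

(** The point is that [N] does not depend on [t]: one [s] per member of [l] met by the orbit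
    suffices, so [N] is a finite intersection of neighborhoods given by continuity of these
    translations. *)
Lemma orbit_sampling (beta : X * X -> Prop) (x : X) (l : list (X -> Prop)) :
  entourage tX beta ->
  exists N, open tX N /\ N x /\
    forall U, In U l -> forall t, U (act t x) ->
      exists s, U (act s x) /\ forall y, N y -> beta (act s y, act s x).
Proof.
  intros (W & oW & rW & sW). induction l as [| U l (N & oN & hN & K)].
  - exists (fun _ => True). repeat split; auto using open_full. intros U [].
  - destruct (classic (exists s, U (act s x))) as [(s & hs) | no].
    + destruct (prod_open_diag_square oW (rW (act s x)))
        as (V & oV & hV & sq).
      destruct (translation_continuous_at oV hV) as (B & oB & hB & KB).
      exists (fun y => N y /\ B y). repeat split; auto using open_inter.
      intros U' [<- | HU'] t ht.
      * exists s. split; auto. intros y [_ hy]. auto.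
      * destruct (K U' HU' t ht) as (s' & h1 & h2).
        exists s'. split; auto. intros y [hy _]; auto.
    + exists N. repeat split; auto.
      intros U' [<- | HU'] t ht; [destruct no; eauto | eauto].
Qed.

Lemma furstenberg_equicontinuous :
  furstenberg tX act -> equicontinuous tX act.
Proof.
  intros HF alpha Ha.
  destruct (entourage_halving HXc HXh Ha) as (V & eV & sV & tV).
  destruct (HF V eV) as (beta & eb & Hb).
  destruct eb as (W & oW & rW & sW).
  assert (eb : entourage tX beta) by (exists W; auto).
  destruct (@HXc (fun U => open tX U /\
    forall a b, U a -> U b -> W (a, b))) as (l & lF & lcov).
  { intros U [H _]; exact H. }
  { intros x.
    destruct (prod_open_diag_square oW (rW x)) as (U & ? & ? & ?).
    eauto. }
  (* This union of squares is an entourage as soon as every point has one such [N], which reduces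
     equicontinuity to a single point [x]. *)
  exists (fun p => exists N, (open tX N /\ forall y z t,
    N y -> N z -> alpha (act t y, act t z)) /\ N (fst p) /\ N (snd p)).
  split.
  - apply entourage_squares; [intros U [H _]; exact H |].
    intros x. destruct (orbit_sampling x l eb) as (N & oN & hN & K).
    exists N. repeat split; auto. intros y z t hy hz.
    destruct (lcov (act t x)) as (U & HU & hU).
    destruct (K U HU t hU) as (s & hs & Hs).
    destruct (lF U HU) as [_ sq].
    assert (Hm : forall w, act (mul t (inv s)) (act s w) = act t w).
    { intros w. destruct Hact as (_ & am & _).
      rewrite am, act_inv_act. reflexivity. }
    (* Furstenberg at the point [s x] for the element [t s^-1]: it sends [s x] to [t x], in the same
       [W]-small set [U], and [s w] to [t w], where [s w] is [beta]-close to [s x] by [Hs]. *)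
    assert (near : forall w, N w -> V (act t w, act s x)).
    { intros w hw. rewrite <- Hm. apply Hb; auto.
      rewrite Hm. auto. }
    eapply tV; [apply near; exact hy | apply sV, near; exact hz].
  - intros x y (N & [_ K] & hx & hy) t. auto.
Qed.

Lemma equicontinuous_furstenberg :
  equicontinuous tX act -> furstenberg tX act.
Proof.
  intros HE alpha Ha.
  destruct (entourage_halving HXc HXh Ha) as (V & eV & sV & tV).
  destruct (HE V eV) as (beta & eb & Hb).
  (* The middle point is [t x]: [beta] brings [t y] near it, and [V] puts it near [x]. *)
  exists (fun p => V p /\ beta p). split; [apply entourage_inter; auto |].
  intros x y t [h1 _] [_ h2]. eauto.
Qed.

Lemma equicontinuous_almost_automorphic (x : X) :
  equicontinuous tX act -> almost_automorphic tX inv act x.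
Proof.
  intros HE I le t y _ Hconv U oU hU.
  destruct (entourage_ball_in_open HXc HXh oU hU) as (alpha & ea & ha).
  destruct (HE alpha ea) as (beta & (W & oW & rW & sW) & Hb).
  destruct (prod_open_diag_square oW (rW y)) as (N & oN & hN & sq).
  destruct (Hconv N oN hN) as (i0 & Hi0).
  exists i0. intros i Hi. apply ha.
  (* Both [t_i x] and [y] lie in [N], hence are [beta]-close, and [beta] serves all the elements
     [t_i^-1] at once. *)
  rewrite <- (act_inv_act (t i) x) at 1. auto.
Qed.

End Flow.

Unset Implicit Arguments.
Set Strict Implicit.

Theorem mainTheorem1 (X T : Type) (tX : topology X) (tT : topology T)
  (mul : T -> T -> T) (inv : T -> T) (e : T) (act : T -> X -> X)
  (HXc : compact tX) (HXh : hausdorff tX)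
  (HT : topological_group tT mul inv e)
  (Hact : continuous_action tT tX mul e act) :
  (furstenberg tX act <-> equicontinuous tX act) /\
  (furstenberg tX act -> forall x : X, almost_automorphic tX inv act x).
Proof.
  repeat split.
  - exact (furstenberg_equicontinuous HXc HXh HT Hact).
  - exact (equicontinuous_furstenberg HXc HXh).
  - intros HF x. apply (equicontinuous_almost_automorphic HXc HXh HT Hact).
    exact (furstenberg_equicontinuous HXc HXh HT Hact HF).
Qed.
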